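(* For Lebesgue almost all $x\in(0,1)$, $$\limsup_{n\to\infty}\frac{\log R_n(x)-\log n}{\log\log n}=1\quad\text{and}\quad\limsup_{n\to\infty}\frac{\log M_n(x)-\log n}{\log\log n}=1.$$
   Context: Signed Engel expansion: define $T\colon[0,1)\to[0,1)$ by: for $k\in\mathbb{N}$, $Tx=\lceil 1/x\rceil x-1$ if $x\in(\frac{1}{2k},\frac{1}{2k-1})$; $Tx=1-\lfloor 1/x\rfloor x$ if $x\in(\frac{1}{2k+1},\frac{1}{2k})$; $Tx=0$ if $x\in\{0\}\cup\{1/n\colon n\ge 2\}$. For $x\in(0,1)$, $d_1(x)=\lceil 1/x\rceil$ if $x\in[\frac{1}{2k},\frac{1}{2k-1})$ for some $k\in\mathbb{N}$, and $d_1(x)=\lfloor 1/x\rfloor$ if $x\in[\frac{1}{2k+1},\frac{1}{2k})$ for some $k\in\mathbb{N}$; $d_{n+1}(x)=d_1(T^nx)$. For irrational $x\in(0,1)$, $R_1(x)=d_1(x)$, $R_n(x)=d_n(x)/d_{n-1}(x)$ for $n\ge2$, and $M_n(x)=\max\{R_k(x)\colon 1\le k\le n\}$. *)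

(* Defs.v *)
From HB Require Import structures.
From mathcomp Require Import all_boot all_order all_algebra.
From mathcomp Require Import all_classical all_reals all_analysis.
Set Implicit Arguments. Unset Strict Implicit. Unset Printing Implicit Defensive.
Import Order.TTheory GRing.Theory Num.Theory.
Local Open Scope ring_scope.

Section SignedEngel.
Variable R : realType.

(* the paper's map T : [0,1) -> [0,1) (extended arbitrarily by 0 outside) *)
Definition sE_T (x : R) : R :=
  if `[< exists k : nat, (0 < k)%N /\ 1 / (2 * k%:R) < x /\ x < 1 / (2 * k%:R - 1) >]
  then (Num.ceil (1 / x))%:~R * x - 1
  else if `[< exists k : nat, (0 < k)%N /\ 1 / (2 * k%:R + 1) < x /\ x < 1 / (2 * k%:R) >]
  then 1 - (Num.floor (1 / x))%:~R * x
  else 0.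

Definition sE_d1 (x : R) : R :=
  if `[< exists k : nat, (0 < k)%N /\ 1 / (2 * k%:R) <= x /\ x < 1 / (2 * k%:R - 1) >]
  then (Num.ceil (1 / x))%:~R
  else (Num.floor (1 / x))%:~R.

Definition sE_d (n : nat) (x : R) : R := sE_d1 (iter n.-1 sE_T x).

Definition sE_R (n : nat) (x : R) : R :=
  if (n <= 1)%N then sE_d 1 x else sE_d n x / sE_d n.-1 x.

Definition sE_M (n : nat) (x : R) : R :=
  \big[Num.max/sE_R 1 x]_(1 <= k < n.+1) sE_R k x.


End SignedEngel.

(* Main.v *)
(** Write [x = (1 + (-1)^b y) / (2 k)] with [2 k] the first digit of [x] and
  [y = T x].  Given the previous digits and branches, [T^n x] is uniformly
  distributed on an interval [(0, 1 / (2 (k + b) - 1))], hence the probability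
  that [R_(n+1) > t] lies between [c / t] and [C / t] whatever the past.  As
  [sum 1 / (n (ln n)^(1+d))] converges for [d > 0] and diverges for [d = 0], a
  Borel-Cantelli argument gives [R_n <= n (ln n)^(1+d)] eventually and
  [R_n >= n ln n] infinitely often, almost surely.  These bounds determine the
  first upper limit, and they pass from [R_n] to [M_n] because the thresholds
  increase to infinity.

  Conditioning is avoided: an event on the digits following the state [(k, b)]
  is the disjoint union of contracted copies of the shifted event, so the bounds
  on its measure follow by induction, and the lengths of the cylinders telescope. *)
Require Import Defs.
From HB Require Import structures.
From mathcomp Require Import all_boot all_order all_algebra.
From mathcomp Require Import all_classical all_reals all_analysis.
From mathcomp Require Import measurable_realfun zify ring lra.
Import Order.TTheory GRing.Theory Num.Theory.
Local Open Scope ring_scope.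

(** * Upper bounds for Lebesgue outer measure *)

Section OuterBound.
Context {R : realType}.
Local Notation mu := (@lebesgue_measure R).
Local Open Scope classical_set_scope.

(* The Lebesgue outer measure of [A] is at most [c]; [A] need not be measurable. *)
Definition outer_le (A : set R) (c : R) := forall e : R, 0 < e ->
  exists U : set (measurableTypeR R),
    [/\ measurable U, A `<=` U & (mu U <= (c + e)%:E)%E].

Lemma outer_leS (A B : set R) (c c' : R) :
  A `<=` B -> c <= c' -> outer_le B c -> outer_le A c'.
Proof.
move=> AB cc' Bc e e0; have [U [mU BU Uc]] := Bc e e0.
exists U; split => //; first exact: subset_trans BU.
by rewrite (le_trans Uc)// lee_fin lerD2r.
Qed.

Lemma outer_le_adherent (A : set R) (c : R) :
  (forall e, 0 < e -> outer_le A (c + e)) -> outer_le A c.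
Proof.
move=> Ac e e0; have e20 : 0 < e / 2 by rewrite divr_gt0.
by have := Ac _ e20 _ e20; rewrite -addrA -splitr.
Qed.

Lemma outer_leU (A B : set R) (a b : R) :
  outer_le A a -> outer_le B b -> outer_le (A `|` B) (a + b).
Proof.
move=> Aa Bb e e0; have e20 : 0 < e / 2 by rewrite divr_gt0.
have [U [mU AU Ua]] := Aa _ e20; have [V [mV BV Vb]] := Bb _ e20.
exists (U `|` V); split; [exact: measurableU|exact: setUSS|].
apply: (le_trans (measureU2 _ mU mV)).
by rewrite (le_trans (leeD Ua Vb))// -EFinD lee_fin addrACA -splitr.
Qed.

Lemma outer_le0 : outer_le set0 0.
Proof.
by move=> e e0; exists set0; split => //; rewrite measure0 add0r lee_fin ltW.
Qed.

Lemma outer_le_itv (a b : R) : a <= b -> outer_le [set x | a < x < b] (b - a).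
Proof.
move=> ab e e0; exists `]a, b[%classic; split.
- exact: measurable_itv.
- by move=> x /=; rewrite in_itv.
rewrite lebesgue_measure_itv/= lte_fin; case: ifPn => _; rewrite ?lee_fin.
  by rewrite lerDl ltW.
by rewrite addr_ge0 ?subr_ge0// ltW.
Qed.

Lemma measurable_fun_affine (r s : R) :
  measurable_fun setT ((fun x => r * x + s) : measurableTypeR R -> measurableTypeR R).
Proof.
apply: continuous_measurable_fun => x.
by apply: cvgD; [exact: mulrl_continuous|exact: cvg_cst].
Qed.

(** By uniqueness of Lebesgue measure: the image of [r * mu] under the affine map gives every
    interval []a, b]] its length. *)
Lemma lebesgue_measure_affine (r s : R) (U : set (measurableTypeR R)) : 0 < r ->
  measurable U -> mu ((fun x => r * x + s) @^-1` U) = ((r^-1)%:E * mu U)%E.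
Proof.
move=> r0 mU; have mf := measurable_fun_affine r s.
have -> : mu U = pushforward (mscale (NngNum (ltW r0)) mu)
    ((fun x => r * x + s) : measurableTypeR R -> measurableTypeR R) U.
  apply: lebesgue_measure_unique => //.
  move=> _ [[a b]] _ <-/=; rewrite /pushforward /mscale/=.
  have -> : (fun x => r * x + s) @^-1` `]a, b] =
      `](a - s) / r, (b - s) / r]%classic :> set R.
    apply/seteqP; split => x /=; rewrite !in_itv/= -ltrBlDr -lerBrDr;
      by rewrite ltr_pdivrMr// ler_pdivlMr// mulrC.
  rewrite !lebesgue_measure_itv/= !lte_fin ltr_pM2r ?invr_gt0// ltrD2r.
  case: ifPn => _; last by rewrite mule0.
  rewrite -!EFinD -EFinM; congr EFin; field; lra.
by rewrite /pushforward /mscale/= muleA -EFinM mulVf ?gt_eqF// mul1e.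
Qed.

(* [x = (1 + (-1)^b y) / d] is the inverse of the branch of [sE_T] with digit [d]. *)
Lemma outer_le_branch (b : bool) (d : R) (A : set R) (c : R) : 0 < d ->
  outer_le A c ->
  outer_le [set x | exists2 y, A y & x = (1 + (-1) ^+ b * y) / d] (c / d).
Proof.
move=> d0 Ac e e0; have [U [mU AU Uc]] := Ac (e * d) (mulr_gt0 e0 d0).
pose V : set (measurableTypeR R) := if b then -%R @^-1` U else U.
have mN : measurable_fun setT (-%R : measurableTypeR R -> measurableTypeR R).
  exact: oppr_measurable.
have mV : measurable V.
  rewrite /V; case: (b) => //.
  by rewrite -[X in measurable X]setTI; exact: mN.
have muV : mu V = mu U by rewrite /V; case: (b) => //; exact: lebesgue_measureN.
exists ((fun x => d * x + - 1) @^-1` V); split.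
- by rewrite -[X in measurable X]setTI; exact: measurable_fun_affine.
- move=> x [y Ay ->]/=; rewrite mulrC mulfVK ?gt_eqF// addrAC subrr add0r /V.
  by case: (b) => /=; rewrite ?expr0 ?expr1 ?mul1r ?mulN1r ?opprK; exact: AU.
- rewrite lebesgue_measure_affine// muV.
  rewrite (le_trans (lee_wpmul2l _ Uc)) ?lee_fin ?invr_ge0 ?(ltW d0)//.
  rewrite le_eqVlt; apply/orP; left; apply/eqP.
  by field; lra.
Qed.

Lemma outer_le0_negligible (A : set R) : outer_le A 0 -> mu.-negligible A.
Proof.
move=> A0.
have /choice[U HU] (n : nat) : exists U : set (measurableTypeR R),
    [/\ measurable U, A `<=` U & (mu U <= (n.+1%:R^-1)%:E)%E].
  by have [|U] := A0 n.+1%:R^-1; [rewrite invr_gt0|rewrite add0r => ?; exists U].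
exists (\bigcap_n U n); split.
- by apply: bigcapT_measurable => n; have [] := HU n.
- apply/eqP; rewrite eq_le measure_ge0 andbT.
  apply/lee_addgt0Pr => e e0; rewrite add0e.
  near \oo => n; have [mU _ Un] := HU n.
  have : (mu (\bigcap_n U n) <= mu (U n))%E.
    apply: le_measure; rewrite ?inE//; last exact: bigcap_inf.
    by apply: bigcapT_measurable => k; have [] := HU k.
  move=> /le_trans; apply; apply: (le_trans Un).
  by rewrite lee_fin ltW//; near: n; exact: near_infty_natSinv_lt (PosNum e0).
- by move=> x Ax n _; have [_ + _] := HU n; exact.
Unshelve. all: by end_near. Qed.

(** Each [A n] is enlarged to a measurable set, with [c n] itself as the admissible error. The
    measures are then at most [2 * c n], still summable, and the measurable form of the first
    Borel-Cantelli lemma applies. *)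
Lemma outer_le_borel_cantelli (A : nat -> set R) (c : nat -> R) (B : R) :
  (forall n, 0 < c n) -> (forall n, outer_le (A n) (c n)) ->
  (forall n, \sum_(i < n) c i <= B) -> mu.-negligible (lim_sup_set A).
Proof.
move=> c0 Ac cB.
have /choice[U HU] (n : nat) : exists U : set (measurableTypeR R),
    [/\ measurable U, A n `<=` U & (mu U <= (2 * c n)%:E)%E].
  by have [U] := Ac n _ (c0 n); rewrite -mulr2n -[_ *+ 2]mulr_natl => ?; exists U.
have mU n : @measurable _ (measurableTypeR R) (U n) by have [] := HU n.
exists (lim_sup_set U); split.
- by apply: bigcapT_measurable => k; apply: bigcup_measurable => j _; exact: mU.
- apply: lim_sup_set_cvg0 => //.
  apply: (@le_lt_trans _ _ (2 * B)%:E); last exact: ltry.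
  apply: lime_le; first exact: is_cvg_nneseries.
  apply: nearW => n; rewrite big_mkord.
  apply: (@le_trans _ _ (\sum_(i < n) (2 * c i)%:E)%E).
    by apply: lee_sum => i _; case: (HU i).
  by rewrite sumEFin lee_fin -mulr_sumr ler_pM2l.
- move=> x Ax n _; have [k nk Akx] := Ax n I.
  by exists k => //; have [_ + _] := HU k; exact.
Qed.

End OuterBound.

(** * One step of the signed Engel map *)

Section SignedEngelSteps.
Context {R : realType}.

Lemma irrational_mulrn_neq1 (x : R) (n : nat) : irrational x -> n%:R * x <> 1.
Proof.
move=> xirr nx1; apply: xirr; exists n%:R^-1 => //.
rewrite fmorphV/= ratr_nat; have [n0|n0] := eqVneq (n%:R : R) 0.
  by move: nx1; rewrite n0 mul0r => /eqP; rewrite eq_sym oner_eq0.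
by apply: (mulfI n0); rewrite mulfV.
Qed.

Lemma irrational_branch (b : bool) (k : nat) (y : R) :
  irrational ((1 + (-1) ^+ b * y) / (2 * k%:R)) -> irrational y.
Proof.
move=> xirr [q _ qy]; apply: xirr; exists ((1 + (-1) ^+ b * q) / (2 * k%:R)) => //.
by rewrite -qy fmorph_div/= rmorphD rmorph1 !rmorphM/= rmorph_sign !ratr_nat.
Qed.

Lemma nat_odd_half (n : nat) : (0 < n)%N ->
  exists2 k, (0 < k)%N & n = (2 * k)%N \/ n.+1 = (2 * k)%N.
Proof.
move=> n0; have := odd_double_half n; case: (boolP (odd n)) => on /= nE.
  by exists (n./2).+1 => //; right; lia.
by exists (n./2); [lia|left; lia].
Qed.

(** With [n] the integer part of [1 / x], irrationality puts [x] strictly between [1 / (n + 1)] and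
    [1 / n]. The digit is the even one of [n] and [n + 1]: [b] is true for [n = 2 k] and false for
    [n + 1 = 2 k]. The bound on [sE_T x] is its value at the odd endpoint, [1 / (2 k + 1)] or
    [1 / (2 k - 1)]. *)
Lemma sE_step (x : R) : irrational x -> 0 < x < 1 ->
  exists (k : nat) (b : bool),
    [/\ (0 < k)%N, sE_d1 x = 2 * k%:R, x = (1 + (-1) ^+ b * sE_T x) / (2 * k%:R),
        0 < sE_T x < (2 * (k + b)%:R - 1)^-1 & irrational (sE_T x)].
Proof.
move=> xirr /andP[x0 x1].
pose n := Num.truncn (1 / x).
have /andP[] : n%:R <= 1 / x < n.+1%:R by rewrite truncn_itv// divr_ge0// ltW.
rewrite ler_pdivlMr// ltr_pdivrMr// => nx1 nx2.
have {}nx1 : n%:R * x < 1.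
  by rewrite lt_neqAle nx1 andbT; apply/eqP/irrational_mulrn_neq1.
have n0 : (0 < n)%N by rewrite lt0n; apply/eqP => n0; move: nx2; rewrite n0; lra.
have lt_nat (a b : nat) : a%:R * x < b%:R * x -> (a < b)%N.
  by rewrite ltr_pM2r// ltr_nat.
have [k k0 nk] := nat_odd_half n n0.
have k0R : 0 < 2 * k%:R - 1 :> R.
  by rewrite subr_gt0; have : 1 <= k%:R :> R; [rewrite ler1n|lra].
have k20 : 0 < 2 * k%:R :> R by lra.
suff [b [dE TE Tlt]] : exists b : bool, [/\ sE_d1 x = 2 * k%:R,
    x = (1 + (-1) ^+ b * sE_T x) / (2 * k%:R)
    & 0 < sE_T x < (2 * (k + b)%:R - 1)^-1].
  exists k, b; split => //; apply: (irrational_branch b k).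
  by rewrite -TE.
(* Parity decides the branch: the first family of intervals forces [n] odd. The weak left inequality
   suits [sE_d1], and [sE_T] after weakening. *)
have first_case k' : (0 < k')%N -> 1 / (2 * k'%:R) <= x ->
    x < 1 / (2 * k'%:R - 1) -> n.+1 = (2 * k')%N.
  move=> k'0; have : 1 <= k'%:R :> R by rewrite ler1n.
  move=> k'1; rewrite ler_pdivrMr ?ltr_pdivlMr; [|lra|lra] => h1 h2.
  have : (n < 2 * k')%N.
    by apply: lt_nat; rewrite natrM; lra.
  have : ((2 * k').-1 < n.+1)%N.
    apply: lt_nat; rewrite -subn1 natrB ?natrM; last lia.
    lra.
  lia.
case: nk => nk.
- exists true; move: nx1 nx2; rewrite -natr1 nk natrM => nx1 nx2.
  have nfirst : ~ exists k' : nat,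
      (0 < k')%N /\ 1 / (2 * k'%:R) <= x /\ x < 1 / (2 * k'%:R - 1).
    by move=> [k' [k'0 [h1 h2]]]; have := first_case k' k'0 h1 h2; lia.
  have fl : (Num.floor (1 / x))%:~R = 2 * k%:R :> R.
    have -> : Num.floor (1 / x) = (2 * k)%N%:Z.
      by apply: floor_def; rewrite intrD -pmulrn natrM ler_pdivlMr// ltr_pdivrMr//; lra.
    by rewrite -pmulrn natrM.
  have d1E : sE_d1 x = 2 * k%:R by rewrite /sE_d1; case: asboolP.
  have TE : sE_T x = 1 - 2 * k%:R * x.
    rewrite /sE_T; case: asboolP => [[k' [k'0 [h1 h2]]]|_].
      by exfalso; apply: nfirst; exists k'; split => //; split => //; exact: ltW.
    rewrite fl; case: asboolP => // nsecond; exfalso; apply: nsecond.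
    by exists k; rewrite ltr_pdivrMr ?ltr_pdivlMr; [split => //; split; lra|lra|lra].
  split=> //; first by rewrite TE expr1; field; lra.
  have ? : 0 < 2 * (k%:R + 1) - 1 :> R by lra.
  rewrite TE addn1 -natr1 subr_gt0 -[X in _ && (_ < X)]div1r ltr_pdivlMr//.
  apply/andP; split; first lra.
  nra.
- exists false; move: nx1 nx2; rewrite nk natrM.
  have -> : n%:R = 2 * k%:R - 1 :> R by rewrite -natrM -nk -natr1; lra.
  move=> nx1 nx2.
  have cl : (Num.ceil (1 / x))%:~R = 2 * k%:R :> R.
    have -> : Num.ceil (1 / x) = (2 * k)%N%:Z.
      by apply: ceil_def; rewrite intrB -pmulrn natrM ltr_pdivlMr// ler_pdivrMr//; lra.
    by rewrite -pmulrn natrM.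
  have TE : sE_T x = 2 * k%:R * x - 1.
    rewrite /sE_T cl; case: asboolP => // nfirst; exfalso; apply: nfirst.
    by exists k; rewrite ltr_pdivrMr ?ltr_pdivlMr; [split => //; split; lra|lra|lra].
  split.
  + rewrite /sE_d1 cl; case: asboolP => // nfirst; exfalso; apply: nfirst.
    by exists k; rewrite ler_pdivrMr ?ltr_pdivlMr; [split => //; split; lra|lra|lra].
  + by rewrite TE expr0; field; lra.
  + rewrite TE addn0 subr_gt0 -[X in _ && (_ < X)]div1r ltr_pdivlMr//.
    apply/andP; split; first lra.
    nra.
Qed.

End SignedEngelSteps.

(** * Measure of digit events relative to the interval of a state *)

Section DigitEvents.
Context {R : realType}.
Local Open Scope classical_set_scope.

(* A digit [2 k] reached through the branch [b] is followed by a point of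
  [(0, sE_len (k + b))]. *)
Definition sE_len (j : nat) : R := (2 * j%:R - 1)^-1.

Lemma two_natB1_ge1 (j : nat) : (0 < j)%N -> 1 <= 2 * j%:R - 1 :> R.
Proof. by rewrite -(ler_nat R) => ?; lra. Qed.

Lemma sE_len_gt0 (j : nat) : (0 < j)%N -> 0 < sE_len j.
Proof. by move=> /two_natB1_ge1 ?; rewrite invr_gt0; lra. Qed.

Lemma sE_len_le (i j : nat) : (0 < i)%N -> (i <= j)%N -> sE_len j <= sE_len i.
Proof.
move=> i0 ij; have := two_natB1_ge1 i i0; have := two_natB1_ge1 j (leq_trans i0 ij).
rewrite /sE_len => ? ?; rewrite lef_pV2 ?posrE; [|lra|lra].
by move: ij; rewrite -(ler_nat R) => ?; lra.
Qed.

(** Points with digit [2 k] fill the gap between [1 / (2 k + 1)] and [1 / (2 k - 1)], so bounds on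
    the point and on its digit can be exchanged. *)
Lemma sE_branch_bounds (k : nat) (b : bool) (y : R) : (0 < k)%N ->
  0 < y < sE_len (k + b) ->
  sE_len k.+1 < (1 + (-1) ^+ b * y) / (2 * k%:R) < sE_len k.
Proof.
rewrite /sE_len => k0; have := two_natB1_ge1 k k0 => k1 /andP[y0].
have ? : 0 < 2 * k.+1%:R - 1 :> R by rewrite -natr1; lra.
have ? : 0 < 2 * k%:R - 1 :> R by lra.
rewrite ltr_pdivlMr ?ltr_pdivrMr; [|lra|lra].
rewrite ![_^-1 * _]mulrC !ltr_pdivrMr// ltr_pdivlMr// -natr1.
case: b => /=; rewrite ?addn0 ?addn1 ?expr0 ?expr1 -?natr1 -div1r ltr_pdivlMr; try lra.
  by move=> yk; apply/andP; split; nra.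
by move=> yk; apply/andP; split; nra.
Qed.

(** Only finitely many digits are allowed, so finite subadditivity and induction suffice. Larger
    digits are treated as one short interval at 0. *)
Definition sE_preimage (A : nat -> bool -> set R) (j j' : nat) : set R :=
  [set x | exists (k : nat) (b : bool), [/\ (j <= k < j')%N, 0 < sE_T x < sE_len (k + b),
    x = (1 + (-1) ^+ b * sE_T x) / (2 * k%:R) & A k b (sE_T x)]].

(* The two branches with digit [2 k] have total length [sE_len k - sE_len k.+1]. *)
Lemma outer_le_preimage (A : nat -> bool -> set R) (c : R) (j n : nat) :
  (0 < j)%N -> (forall k b, (0 < k)%N -> outer_le (A k b) (c * sE_len (k + b))) ->
  outer_le (sE_preimage A j (j + n)) (c * (sE_len j - sE_len (j + n))).
Proof.
move=> j0 Ac; elim: n => [|n IH].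
  rewrite addn0 subrr mulr0; apply: outer_leS outer_le0 => // x [k [b [+ _ _ _]]].
  by rewrite ltnNge andbN.
have k0 : (0 < j + n)%N by lia.
have k20 : 0 < 2 * (j + n)%:R :> R by have := two_natB1_ge1 _ k0; lra.
apply: (outer_leS _ _ _ _ _ _ (outer_leU _ _ _ _ IH
  (outer_leU _ _ _ _ (outer_le_branch false _ _ _ k20 (Ac (j + n)%N false k0))
                     (outer_le_branch true _ _ _ k20 (Ac (j + n)%N true k0))))).
- move=> x [k [b [/andP[jk kn] Tx xE Ax]]].
  have [kn'|kn'] := ltnP k (j + n); first by left; exists k, b; rewrite jk kn'.
  have {kn'} kE : k = (j + n)%N by lia.
  right; case: b xE {Tx} Ax => /= xE Ax; [right|left]; exists (sE_T x);
    by rewrite -?kE.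
- rewrite /= !addnS !addn0 /sE_len -natr1.
  have := two_natB1_ge1 _ k0 => ?; have := two_natB1_ge1 _ j0 => ?.
  by rewrite le_eqVlt; apply/orP; left; apply/eqP; field; lra.
Qed.

(** Entry 0 is the digit preceding [x], so that the ratio across the current state is a property of
    the sequence. *)
Definition sE_dseq (k : nat) (x : R) (i : nat) : R :=
  if i is 0 then 2 * k%:R else sE_d i x.

Definition sE_event (P : (nat -> R) -> Prop) (k : nat) (b : bool) : set R :=
  [set x | [/\ irrational x, 0 < x < sE_len (k + b) & P (sE_dseq k x)]].

Lemma sE_dseqS (k k' : nat) (x : R) : sE_d1 x = 2 * k'%:R ->
  (fun i => sE_dseq k x i.+1) = sE_dseq k' (sE_T x).
Proof.
by move=> dE; apply/funext => -[|i] //=; rewrite /sE_d /= -iterSr.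
Qed.

(** The restriction [k + b <= k'] on the next digit comes from comparing [x > 1 / (2 k' + 1)] with
    [x < 1 / (2 (k + b) - 1)]. *)
Lemma sE_event_step (P Q : (nat -> R) -> Prop) (k : nat) (b : bool) (x : R) :
  (0 < k)%N -> sE_event P k b x ->
  (forall s, P s -> Q (fun i => s i.+1)) ->
  exists (k' : nat) (b' : bool), [/\ (k + b <= k')%N, sE_d1 x = 2 * k'%:R,
    0 < sE_T x < sE_len (k' + b'),
    x = (1 + (-1) ^+ b' * sE_T x) / (2 * k'%:R) & sE_event Q k' b' (sE_T x)].
Proof.
move=> k0 [xirr /andP[x0 xlt] Px] PQ.
have xlt1 : x < 1.
  rewrite (lt_le_trans xlt)// /sE_len invf_le1 ?two_natB1_ge1 ?addn_gt0 ?k0//.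
  by rewrite (lt_le_trans ltr01)// two_natB1_ge1// addn_gt0 k0.
have [k' [b' [k'0 dE xE Tx Tirr]]] := sE_step x xirr (introT andP (conj x0 xlt1)).
exists k', b'; split => //; last first.
  by split => //; rewrite -(sE_dseqS k k' x dE); exact: PQ.
have /andP[h _] := sE_branch_bounds _ _ _ k'0 Tx.
rewrite -xE in h; rewrite -ltnS ltnNge; apply/negP => h'.
have := lt_trans h xlt; rewrite ltNge => /negP; apply; exact: sE_len_le.
Qed.

(** A bound proportional to the length of the state's interval survives the insertion of one digit,
    with the same constant, because the lengths of the branches telescope to that of the
    interval. *)
Lemma outer_le_event_step (P Q : (nat -> R) -> Prop) (c : R) :
  0 <= c -> (forall s, P s -> Q (fun i => s i.+1)) ->
  (forall k b, (0 < k)%N -> outer_le (sE_event Q k b) (c * sE_len (k + b))) ->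
  forall k b, (0 < k)%N -> outer_le (sE_event P k b) (c * sE_len (k + b)).
Proof.
move=> c0 PQ Qc k b k0; apply: outer_le_adherent => e e0.
have j0 : (0 < k + b)%N by lia.
(* Points with digit at least [2 (k + b + n)] lie below [sE_len (k + b + n)], which is at most
   [1 / n] and hence at most [e]. *)
pose n := (Num.truncn e^-1).+1.
have n0 : (0 < k + b + n)%N by lia.
have ne : sE_len (k + b + n) <= e.
  rewrite /sE_len -[leRHS]invrK lef_pV2 ?posrE ?invr_gt0//; last first.
    by have := two_natB1_ge1 _ n0; lra.
  have := truncnS_gt e^-1; rewrite -/n natrD => ?.
  have : 1 <= (k + b)%:R :> R by rewrite ler1n.
  have : 0 <= n%:R :> R by [].
  lra.
apply: (outer_leS _ _ _ _ _ _ (outer_leU _ _ _ _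
   (outer_le_preimage _ _ _ n j0 Qc) (outer_le_itv 0 _ (ltW (sE_len_gt0 _ n0))))).
- move=> x Px; have [k' [b' [kk' _ Tx xE Qx]]] := sE_event_step P Q k b x k0 Px PQ.
  have [kn|kn] := ltnP k' (k + b + n); first by left; exists k', b'; rewrite kk' kn.
  right; have [_ /andP[x0 _] _] := Px; apply/andP; split=> //.
  have k'0 : (0 < k')%N by lia.
  have /andP[_] := sE_branch_bounds _ _ _ k'0 Tx; rewrite -xE => /lt_le_trans; apply.
  exact: sE_len_le.
- rewrite subr0 mulrBr lerD//.
  by rewrite gerBl mulr_ge0// ltW// sE_len_gt0.
Qed.

Lemma outer_le_event_shift (P : (nat -> R) -> Prop) (c : R) (N : nat) : 0 <= c ->
  (forall k b, (0 < k)%N -> outer_le (sE_event P k b) (c * sE_len (k + b))) ->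
  forall k b, (0 < k)%N ->
  outer_le (sE_event (fun s => P (fun i => s (N + i)%N)) k b) (c * sE_len (k + b)).
Proof.
move=> c0; elim: N P => [//|N IH] P Pc.
by apply: outer_le_event_step (IH P Pc).
Qed.

(** A first digit [2 k'] with [k' > t k] forces [x < 1 / (2 k' - 1) < 1 / (k t)]. The constant 3
    comes from [2 (k + b) - 1 <= 2 k + 1 <= 3 k]. *)
Lemma outer_le_large_ratio (t : R) (k : nat) (b : bool) : 1 <= t -> (0 < k)%N ->
  outer_le (sE_event (fun s => t * s 0 < s 1) k b) (3 / t * sE_len (k + b)).
Proof.
move=> t1 k0; have t0 : 0 < t by lra.
have kb0 : (0 < k + b)%N by lia.
have k1 : 1 <= k%:R :> R by rewrite ler1n.
have kt1 : 1 <= k%:R * t by rewrite mulr_ege1.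
have kt0 : 0 < k%:R * t by lra.
apply: (outer_leS _ _ _ _ _ _ (outer_le_itv 0 (k%:R * t)^-1 _)) => //.
- move=> x Px.
  have [//|k' [b' [kk' dE Tx xE _]]] :=
    sE_event_step _ (fun=> True) k b x k0 Px.
  have [_ /andP[x0 _]] := Px; rewrite /= /sE_d /= dE => tk; rewrite x0/=.
  have k'0 : (0 < k')%N by lia.
  have /andP[_] := sE_branch_bounds _ _ _ k'0 Tx; rewrite -xE => /lt_trans; apply.
  by rewrite /sE_len ltf_pV2 ?posrE//; [lra|have := two_natB1_ge1 _ k'0; lra].
- have := two_natB1_ge1 _ kb0; rewrite subr0 /sE_len; set m := 2 * _ - 1 => m1.
  have mk : m <= 3 * k%:R.
    have : b%:R <= 1 :> R by case: b {kb0 m m1}.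
    by rewrite /m natrD; lra.
  have -> : 3 / t / m = 3 / (t * m) by field; lra.
  have tm0 : 0 < t * m by rewrite mulr_gt0//; lra.
  by rewrite ler_pdivlMr// mulrC ler_pdivrMr//; nra.
- by rewrite invr_ge0 ltW.
Qed.

(** Bounding the first ratio cuts off all large digits and so loses a fixed proportion of the
    interval; the remaining constraints are handled by induction with the shifted thresholds,
    uniformly in the new state. *)
Lemma outer_le_small_ratios (n : nat) (t : nat -> R) (k : nat) (b : bool) :
  (forall i, 1 <= t i) -> (0 < k)%N ->
  outer_le (sE_event (fun s => forall i, (i < n)%N -> s i.+1 < t i * s i) k b)
    (\prod_(i < n) (1 - (4 * t i)^-1) * sE_len (k + b)).
Proof.
elim: n t k b => [|n IH] t k b t1 k0; have kb0 : (0 < k + b)%N by lia.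
  rewrite big_ord0 mul1r -[sE_len _]subr0.
  apply: (outer_leS _ _ _ _ _ _ (outer_le_itv 0 _ (ltW (sE_len_gt0 _ kb0)))) => //.
  by move=> x [].
have k1 : 1 <= k%:R :> R by rewrite ler1n.
have tk1 : 1 <= t 0 * k%:R by rewrite mulr_ege1.
(* Admissible digits [2 k'] have [k' < J]. The part lost is [sE_len J], at least
   [sE_len (k + b) / (4 * t 0)] because [2 J - 1 <= 2 t k + 1 <= 4 t k] for [t = t 0]. *)
pose J := (Num.truncn (t 0 * k%:R)).+1.
have /andP[Jle ltJ] : (Num.truncn (t 0 * k%:R))%:R <= t 0 * k%:R < J%:R.
  by rewrite truncn_itv//; lra.
have kJ : (k < J)%N.
  by rewrite -(ltr_nat R) (le_lt_trans _ ltJ)// ler_peMl.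
have jJ : (k + b <= J)%N by case: b {kb0} => /=; rewrite ?addn0 ?addn1// ltnW.
have := outer_le_preimage (sE_event (fun s => forall i, (i < n)%N ->
    s i.+1 < t i.+1 * s i)) _ _ (J - (k + b)) kb0
  (fun k b => IH (fun i => t i.+1) k b (fun i => t1 i.+1)).
rewrite subnKC//; apply: outer_leS.
- move=> x Px.
  have [|k' [b' [kk' dE Tx xE Qx]]] := sE_event_step _
    (fun s => forall i, (i < n)%N -> s i.+1 < t i.+1 * s i) k b x k0 Px.
    by move=> s h i ni; exact: h.
  exists k', b'; split => //; rewrite kk' /=.
  have [_ _ /(_ 0 isT)] := Px; rewrite /= /sE_d /= dE => k't.
  by rewrite -(ltr_nat R); lra.
- rewrite big_ord_recl/= mulrAC [leLHS]mulrC ler_wpM2r//.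
    apply: prodr_ge0 => i _; rewrite subr_ge0 invf_le1; have := t1 i.+1; lra.
  rewrite mulrBl mul1r lerD2l lerN2 /sE_len -invfM lef_pV2 ?posrE.
  + have -> : J%:R = (Num.truncn (t 0 * k%:R))%:R + 1 :> R by rewrite natr1.
    have ? : 0 <= t 0 * b%:R by rewrite mulr_ge0// (le_trans ler01).
    have ? : t 0 <= t 0 * k%:R by rewrite ler_peMr// (le_trans ler01).
    by rewrite natrD; lra.
  + by have := two_natB1_ge1 _ kb0; have := t1 0 => ? ?; rewrite !mulr_gt0//; lra.
  + by have := two_natB1_ge1 J isT; lra.
Qed.

End DigitEvents.

(** * From states to the ratios of a point of the unit interval *)

Section AlmostEverywhere.
Context {R : realType}.
Local Notation mu := (@lebesgue_measure R).
Local Open Scope classical_set_scope.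

Lemma sE_orbit (x : R) (n : nat) : irrational x -> 0 < x < 1 ->
  irrational (iter n (@sE_T R) x) /\ 0 < iter n (@sE_T R) x < 1.
Proof.
move=> xirr x01; elim: n => [//|n [nirr n01]].
have [k [b [k0 _ _ /andP[T0 Tlt] Tirr]]] := sE_step _ nirr n01.
split => //=; rewrite T0 (lt_le_trans Tlt)// invf_le1 ?two_natB1_ge1 ?addn_gt0 ?k0//.
by rewrite (lt_le_trans ltr01)// two_natB1_ge1// addn_gt0 k0.
Qed.

Lemma sE_d_gt0 (x : R) (n : nat) : irrational x -> 0 < x < 1 -> 0 < sE_d n x.
Proof.
move=> xirr x01; have [nirr n01] := sE_orbit x n.-1 xirr x01.
have [k [b [k0 + _ _ _]]] := sE_step _ nirr n01.
by rewrite /sE_d => ->; rewrite mulr_gt0// ltr0n.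
Qed.

Lemma sE_R_gt0 (x : R) (n : nat) : irrational x -> 0 < x < 1 -> 0 < sE_R n x.
Proof.
by move=> xirr x01; rewrite /sE_R; case: ifP => _; rewrite ?divr_gt0// sE_d_gt0.
Qed.

(** The state [(1, false)] has the whole of [(0, 1)] as its interval and serves as a fictitious
    start. Its digit 2 never enters a ratio, since the events below are shifted by at least one. *)
Lemma sE_len1 : sE_len (1 + false) = 1 :> R.
Proof. by rewrite /sE_len mulr1 mulr2n addrK invr1. Qed.

Lemma outer_le_sE_R_gt (t : R) (n : nat) : 1 <= t -> (0 < n)%N ->
  outer_le [set x : R | [/\ irrational x, 0 < x < 1 & t < sE_R n.+1 x]] (3 / t).
Proof.
case: n => // n t1 _.
have t30 : 0 <= 3 / t by rewrite divr_ge0// (le_trans ler01).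
have := outer_le_event_shift (fun s => t * s 0 < s 1) _ n.+1 t30
  (fun k b k0 => outer_le_large_ratio t k b t1 k0) 1 false isT.
rewrite sE_len1 mulr1; apply: outer_leS => // x [xirr x01 xt].
split => //; first by rewrite sE_len1.
by move: xt; rewrite /sE_R /= addn0 addn1 ltr_pdivlMr// sE_d_gt0.
Qed.

Lemma outer_le_sE_R_lt (t : nat -> R) (N n : nat) : (forall i, 1 <= t i) ->
  (0 < N)%N ->
  outer_le [set x : R | [/\ irrational x, 0 < x < 1 &
      forall i, (i < n)%N -> sE_R (N + i).+1 x < t i]]
    (\prod_(i < n) (1 - (4 * t i)^-1)).
Proof.
case: N => // N t1 _.
have p0 : 0 <= \prod_(i < n) (1 - (4 * t i)^-1).
  by apply: prodr_ge0 => i _; rewrite subr_ge0 invf_le1; have := t1 i; lra.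
have := outer_le_event_shift (fun s => forall i, (i < n)%N -> s i.+1 < t i * s i)
  _ N.+1 p0 (fun k b k0 => outer_le_small_ratios n t k b t1 k0) 1 false isT.
rewrite sE_len1 mulr1; apply: outer_leS => // x [xirr x01 xt].
split => //; first by rewrite sE_len1.
move=> i /xt; rewrite /sE_R /= addnS ltr_pdivrMr ?sE_d_gt0//.
Qed.

(** * Logarithmic thresholds and the two almost sure bounds *)

Lemma ln_sub_ge (a b : R) : 0 < a -> 0 < b -> 1 - a / b <= ln b - ln a.
Proof.
move=> a0 b0; have ab0 : 0 < a / b by rewrite divr_gt0.
have := @expR_ge1Dx R (ln a - ln b).
by rewrite -ln_div ?posrE// lnK ?posrE// ln_div ?posrE//; lra.
Qed.

(** From this index on [ln (ln n)] is positive, which fixes the sign of every denominator and the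
    monotonicity of the thresholds. *)
Definition nat_e : nat := (Num.truncn (expR 1 : R)).+1.

Lemma ln_nat_e (n : nat) : (nat_e <= n)%N -> 1 < ln (n%:R : R).
Proof.
move=> en; have : expR 1 < n%:R :> R.
  by rewrite (lt_le_trans (truncnS_gt _))// ler_nat.
move=> h; rewrite -ltr_expR lnK// posrE.
exact: lt_trans (expR_gt0 _) h.
Qed.

Lemma lnln_nat_e (n : nat) : (nat_e <= n)%N -> 0 < ln (ln (n%:R : R)).
Proof. by move=> /ln_nat_e; exact: ln_gt0. Qed.

Lemma nat_e_gt0 (n : nat) : (nat_e <= n)%N -> 0 < n%:R :> R.
Proof. by rewrite ltr0n; exact: leq_trans. Qed.

(* The threshold [n (ln n)^(1 + d)]. *)
Definition nln (d : R) (n : nat) : R := n%:R * expR ((1 + d) * ln (ln n%:R)).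

Lemma nln_ge (d : R) (n : nat) : 0 <= d -> (nat_e <= n)%N -> n%:R <= nln d n.
Proof.
move=> d0 en; rewrite /nln ler_peMr// -[leLHS]expR0 ler_expR mulr_ge0//; first lra.
by rewrite ltW// lnln_nat_e.
Qed.

Lemma nln_le (d : R) (m n : nat) : 0 <= d -> (nat_e <= m)%N -> (m <= n)%N ->
  nln d m <= nln d n.
Proof.
move=> d0 em mn; have en := leq_trans em mn.
have m0 := nat_e_gt0 _ em; have n0 := nat_e_gt0 _ en.
have m1 := ln_nat_e _ em; have n1 := ln_nat_e _ en.
rewrite /nln ler_pM ?expR_ge0 ?ler_nat// ler_expR ler_wpM2l//; first lra.
by rewrite !ler_ln ?posrE ?ler_nat//; lra.
Qed.

(** Discrete form of the fact that [- (ln x)^(-d)] has derivative [d / (x (ln x)^(1+d))]: the terms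
    of the series are dominated by telescoping differences. *)
Lemma inv_nln_le (d : R) (n : nat) : 0 < d -> (nat_e <= n)%N ->
  d * (nln d n.+1)^-1 <=
  expR (- d * ln (ln n%:R)) - expR (- d * ln (ln n.+1%:R)).
Proof.
move=> d0 en; have en1 : (nat_e <= n.+1)%N by rewrite ltnW.
have n0 := nat_e_gt0 _ en; have n10 := nat_e_gt0 _ en1.
have l0 := ln_nat_e _ en; have l1 := ln_nat_e _ en1.
set a := ln n%:R in l0 *; set b := ln n.+1%:R in l1 *.
have a0 : 0 < a by lra. have b0 : 0 < b by lra.
have ab : n.+1%:R^-1 <= b - a.
  apply: le_trans (ln_sub_ge _ _ n0 n10).
  by rewrite -natr1 le_eqVlt; apply/orP; left; apply/eqP; field; lra.
have lab : n.+1%:R^-1 / b <= ln b - ln a.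
  apply: le_trans (ln_sub_ge _ _ a0 b0).
  have -> : 1 - a / b = (b - a) / b by field; lra.
  by rewrite ler_wpM2r// invr_ge0 ltW.
have -> : expR (- d * ln a) = expR (- d * ln b) * expR (d * (ln b - ln a)).
  by rewrite -expRD; congr expR; lra.
have -> : (nln d n.+1)^-1 = expR (- d * ln b) * (n.+1%:R^-1 / b).
  rewrite /nln -/b invfM -expRN mulrDl opprD mul1r expRD expRN lnK ?posrE//.
  by rewrite mulNr; ring.
have q0 := expR_gt0 (- d * ln b).
have h : d * (n.+1%:R^-1 / b) <= expR (d * (ln b - ln a)) - 1.
  by apply: (le_trans (ler_wpM2l (ltW d0) lab)); rewrite lerBrDl expR_ge1Dx.
by rewrite mulrCA; apply: (le_trans (ler_wpM2l (ltW q0) h)); rewrite mulrBr mulr1.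
Qed.

Lemma sum_inv_nln_le (d : R) (m n : nat) : 0 < d -> (nat_e <= m)%N ->
  \sum_(i < n) (3 / nln d (m + i).+1) <= 3 / d * expR (- d * ln (ln m%:R)).
Proof.
move=> d0 em.
apply: (@le_trans _ _ (3 / d * (expR (- d * ln (ln m%:R))
                                - expR (- d * ln (ln (m + n)%:R))))); last first.
  by rewrite ler_wpM2l ?divr_ge0 ?ltW// ltrBlDr ltrDl expR_gt0.
elim: n => [|n IH]; first by rewrite big_ord0 addn0 subrr mulr0.
rewrite big_ord_recr/=.
have := inv_nln_le d (m + n) d0 (leq_trans em (leq_addr _ _)).
rewrite addnS; move: IH.
have c0 : 0 < 3 / d by rewrite divr_gt0.
move: (expR _) (expR _) (expR _) (nln d _)^-1 => x y z w IH h.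
have := ler_wpM2l (ltW c0) h; rewrite mulrA divfK ?gt_eqF//; lra.
Qed.

(** The convergence half: the exceptional probabilities [3 / nln d n] are summable. *)
Lemma ae_sE_R_le (d : R) : 0 < d -> \forall x \ae mu, 0 < x < 1 -> irrational x ->
  exists N, forall n, (N <= n)%N -> sE_R n x <= nln d n.
Proof.
move=> d0.
pose A (i : nat) := [set x : R | [/\ irrational x, 0 < x < 1 &
  nln d (nat_e + i).+1 < sE_R (nat_e + i).+1 x]].
have t1 i : 1 <= nln d (nat_e + i).+1.
  apply: le_trans (nln_ge d _ (ltW d0) _); first by rewrite ler1n.
  by rewrite leqW// leq_addr.
have : mu.-negligible (lim_sup_set A).
  apply: (outer_le_borel_cantelli A (fun n => 3 / nln d (nat_e + n).+1) _ _ _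
    (fun n => sum_inv_nln_le d nat_e n d0 (leqnn _))).
  - by move=> n; rewrite divr_gt0// (lt_le_trans ltr01).
  - by move=> n; apply: outer_le_sE_R_gt.
apply: negligibleS => x /= /not_implyP[x01 /not_implyP[xirr xN]] n _.
apply: contrapT => nA; apply: xN; exists (nat_e + n).+1 => m nm.
rewrite leNgt; apply/negP => lt_m; apply: nA.
exists (m.-1 - nat_e)%N; first by rewrite /=; lia.
by rewrite /A /= subnKC ?prednK//; lia.
Qed.

(** Combine [1 - u <= expR (- u)] with [ln (ln (n + 1)) - ln (ln n) <= 1 / (n ln n)]. The right-hand
    side is [(ln (m + n) / ln m)^(-1/4)], which tends to 0. *)
Lemma prod_inv_nln_le (m n : nat) : (nat_e <= m)%N ->
  \prod_(i < n) (1 - (4 * nln 0 (m + i))^-1) <=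
  expR (- 4^-1 * (ln (ln (m + n)%:R) - ln (ln m%:R))).
Proof.
move=> em; have t1 i : 1 <= nln 0 (m + i).
  have h : (nat_e <= m + i)%N by rewrite (leq_trans em)// leq_addr.
  apply: le_trans (nln_ge 0 _ (lexx _) h); rewrite ler1n; exact: leq_trans h.
elim: n => [|n IH]; first by rewrite big_ord0 addn0 subrr mulr0 expR0.
rewrite big_ord_recr/=.
have emn : (nat_e <= m + n)%N by rewrite (leq_trans em)// leq_addr.
have emn1 : (nat_e <= (m + n).+1)%N by rewrite ltnW.
have n0 := nat_e_gt0 _ emn; have n10 := nat_e_gt0 _ emn1.
have l0 := ln_nat_e _ emn; have l1 := ln_nat_e _ emn1.
rewrite addnS; set a := ln (m + n)%:R in l0 *; set b := ln (m + n).+1%:R in l1 *.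
have a0 : 0 < a by lra. have b0 : 0 < b by lra.
have nE : nln 0 (m + n) = (m + n)%:R * a.
  by rewrite /nln addr0 mul1r lnK ?posrE.
have ab : b - a <= (m + n)%:R^-1.
  have := ln_sub_ge _ _ n10 n0; rewrite -/a -/b -natr1 mulrDl divff ?gt_eqF//; lra.
have lab : ln b - ln a <= (m + n)%:R^-1 / a.
  apply: (@le_trans _ _ ((b - a) / a)).
    by have := ln_sub_ge _ _ b0 a0; rewrite mulrBl divff ?gt_eqF//; lra.
  by rewrite ler_wpM2r// invr_ge0 ltW.
have -> : expR (- 4^-1 * (ln b - ln (ln m%:R))) =
  expR (- 4^-1 * (ln a - ln (ln m%:R))) * expR (- 4^-1 * (ln b - ln a)).
  by rewrite -expRD; congr expR; lra.
apply: ler_pM => //.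
- by apply: prodr_ge0 => i _; rewrite subr_ge0 invf_le1; have := t1 i; lra.
- by rewrite subr_ge0 invf_le1; have := t1 n; lra.
- apply: le_trans (expR_ge1Dx _).
  rewrite lerD2l mulNr lerN2 invfM ler_wpM2l ?invr_ge0// nE invfM; exact: lab.
Qed.

(** The divergence half. No independence is invoked: for fixed [N], staying below every later
    threshold has outer measure at most each finite product, hence 0. *)
Lemma ae_sE_R_ge : \forall x \ae mu, 0 < x < 1 -> irrational x ->
  forall N, exists2 n, (N <= n)%N & nln 0 n <= sE_R n x.
Proof.
suff h (N : nat) : \forall x \ae mu, 0 < x < 1 -> irrational x ->
    exists2 n, (N <= n)%N & nln 0 n <= sE_R n x.
  have := ae_foralln h; apply: filterS => x h1 x01 xirr N; exact: h1.
pose m := (nat_e + N)%N.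
have em : (nat_e <= m.+1)%N by rewrite leqW// leq_addr.
pose t (i : nat) := nln 0 (m.+1 + i).
have t1 i : 1 <= t i.
  by apply: le_trans (nln_ge 0 _ (lexx _) _); rewrite ?ler1n// (leq_trans em)// leq_addr.
pose A := [set x : R | [/\ irrational x, 0 < x < 1 & forall i, sE_R (m + i).+1 x < t i]].
suff : mu.-negligible A.
  apply: negligibleS => x /= /not_implyP[x01 /not_implyP[xirr xN]].
  split => // i; rewrite ltNge; apply/negP => le_i; apply: xN.
  by exists (m + i).+1 => //; rewrite /m; lia.
apply: outer_le0_negligible; apply: outer_le_adherent => e e0; rewrite add0r.
(* [L] solves [- (L - ln (ln m.+1)) / 4 = ln e], so the product is at most [e] once
   [ln (ln (m.+1 + n))] exceeds [L]. *)
pose L := ln (ln (m.+1%:R : R)) - 4 * ln e.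
pose n := (Num.truncn (expR (expR L))).+1.
have := outer_le_sE_R_lt t m n t1 isT; apply: outer_leS.
  by move=> x [xirr x01 xt]; split => // i _; exact: xt.
apply: (le_trans (prod_inv_nln_le _ n em)).
rewrite -[leRHS]lnK ?posrE// ler_expR.
have : expR (expR L) < (m.+1 + n)%:R.
  by rewrite (lt_le_trans (truncnS_gt _))// ler_nat leq_addl.
move=> h; have h1 : expR L < ln (m.+1 + n)%:R.
  by rewrite -ltr_expR lnK// posrE (lt_trans _ h)// expR_gt0.
have : L < ln (ln (m.+1 + n)%:R).
  by rewrite -ltr_expR lnK// posrE (lt_trans _ h1)// expR_gt0.
rewrite /L; lra.
Qed.

(** * Upper limits, and passage to the running maximum *)

Lemma limn_esup_eq (u : nat -> R) (l : R) :
  (forall d, 0 < d -> exists N, forall n, (N <= n)%N -> u n <= l + d) ->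
  (forall N, exists2 n, (N <= n)%N & l <= u n) ->
  limn_esup (fun n => (u n)%:E) = l%:E.
Proof.
move=> ub lb; apply/eqP; rewrite eq_le; apply/andP; split.
- apply/lee_addgt0Pr => d d0; have [N hN] := ub d d0.
  apply: (@le_trans _ _ (ereal_sup [set (u n)%:E | n in [set n | (N <= n)%N]])).
    by apply: ereal_inf_lbound; exists [set n | (N <= n)%N] => //; exists N.
  by apply: ge_ereal_sup => _ [n /= Nn <-]; rewrite -EFinD lee_fin hN.
- apply: le_ereal_inf_tmp => _ [V [N _ NV] <-].
  have [n Nn ln] := lb N; apply: (@le_trans _ _ (u n)%:E); first by rewrite lee_fin.
  by apply: ereal_sup_ubound; exists n => //; exact: NV.
Qed.

(** Since [ln (nln d n) = ln n + (1 + d) * ln (ln n)], comparing [r n] with [nln d n] amounts to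
    comparing the quotient with [1 + d]. The lower bound is attained without loss, at [d = 0]. *)
Lemma limn_esup_nln (r : nat -> R) : (forall n, 0 < r n) ->
  (forall d, 0 < d -> exists N, forall n, (N <= n)%N -> r n <= nln d n) ->
  (forall N, exists2 n, (N <= n)%N & nln 0 n <= r n) ->
  limn_esup (fun n => ((ln (r n) - ln n%:R) / ln (ln n%:R))%:E) = 1%:E.
Proof.
move=> r0 ub lb.
have ln_nln d n : (nat_e <= n)%N -> ln (nln d n) = ln n%:R + (1 + d) * ln (ln n%:R).
  by move=> en; rewrite lnM ?posrE ?expR_gt0 ?nat_e_gt0// expRK.
apply: limn_esup_eq => [d d0|N].
- have [N hN] := ub d d0; exists (nat_e + N)%N => n Nn.
  have en : (nat_e <= n)%N by lia.
  rewrite ler_pdivrMr ?lnln_nat_e// lerBlDl -ln_nln// ler_ln ?posrE//.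
    by rewrite hN//; lia.
  by rewrite (lt_le_trans (r0 n))// hN//; lia.
- have [n Nn hn] := lb (nat_e + N)%N; exists n; first lia.
  have en : (nat_e <= n)%N by lia.
  have := ln_nln 0 n en; rewrite addr0 => lnE.
  rewrite ler_pdivlMr ?lnln_nat_e// lerBrDl -lnE ler_ln ?posrE//.
  exact: lt_le_trans (nat_e_gt0 _ en) (nln_ge _ _ (lexx _) en).
Qed.

Lemma sE_R_le_M (x : R) (n : nat) : sE_R n x <= sE_M n x.
Proof.
(* At index 0 the empty maximum is its default [sE_R 1 x], and [sE_R 0 x] is the same first
   digit. *)
case: n => [|n]; first by rewrite /sE_M big_nil.
by apply: (le_bigmax_seq _ n.+1); rewrite // mem_index_iota leqnn/=.
Qed.

(** Late ratios are below their own threshold, hence below the one at [n] by monotonicity. The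
    finitely many early ones are below the constant [B], which the threshold at [n] eventually
    exceeds. *)
Lemma sE_M_le (x : R) (d : R) (N : nat) : 0 <= d ->
  (forall n, (N <= n)%N -> sE_R n x <= nln d n) ->
  exists N', forall n, (N' <= n)%N -> sE_M n x <= nln d n.
Proof.
move=> d0 hN; pose B := \sum_(i < (nat_e + N).+1) `|sE_R i x|.
exists (nat_e + N + (Num.truncn B).+1)%N => n Nn.
have en : (nat_e <= n)%N by lia.
have small k : (k < (nat_e + N).+1)%N -> sE_R k x <= nln d n.
  move=> kN; apply: (@le_trans _ _ B).
    rewrite /B (bigD1 (Ordinal kN))//=.
    by rewrite (le_trans (ler_norm _))// lerDl sumr_ge0.
  apply: le_trans (nln_ge _ _ d0 en).
  apply: le_trans (ltW (truncnS_gt B)) _.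
  by rewrite ler_nat (leq_trans (leq_addl _ _) Nn).
rewrite /sE_M big_seq_cond; apply: bigmax_le => [|k]; first exact: small.
rewrite mem_index_iota andbT => /andP[k1 kn].
have [/small//|Nk] := ltnP k (nat_e + N).+1.
by rewrite (le_trans (hN k _))// ?nln_le//; lia.
Qed.

End AlmostEverywhere.

Theorem theorem1p7 (R : realType) :
  {ae (@lebesgue_measure R), forall x : R, 0 < x < 1 -> irrational x ->
    limn_esup (fun n : nat =>
       (((ln (sE_R n x) - ln n%:R) / ln (ln n%:R))%:E)) = 1%:E /\
    limn_esup (fun n : nat =>
       (((ln (sE_M n x) - ln n%:R) / ln (ln n%:R))%:E)) = 1%:E}.
Proof.
(* Exponents [1 / (m + 1)] form a countable family, so a single null set serves for all [d > 0]. *)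
have ub : \forall x \ae (@lebesgue_measure R), forall m : nat, 0 < x < 1 ->
    irrational x -> exists N, forall n, (N <= n)%N -> sE_R n x <= nln m.+1%:R^-1 n.
  by apply: ae_foralln => m; apply: ae_sE_R_le; rewrite invr_gt0.
have FF := ae_filter_ringOfSetsType (@lebesgue_measure R).
apply: (@filterS2 _ _ FF) ub (@ae_sE_R_ge R) => x ub lb x01 xirr.
have r0 n : 0 < sE_R n x by exact: sE_R_gt0.
have M0 n : 0 < sE_M n x by exact: lt_le_trans (r0 n) (sE_R_le_M x n).
have ubx d : 0 < d -> exists N, forall n, (N <= n)%N -> sE_R n x <= nln d n.
  (* This index makes [1 / (m + 1)] smaller than [d]; past [nat_e] the threshold increases with the
     exponent. *)
  move=> d0; have [N hN] := ub (Num.truncn d^-1) x01 xirr.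
  exists (@nat_e R + N)%N => n Nn; apply: le_trans (hN n _) _; first lia.
  have en : (@nat_e R <= n)%N by lia.
  rewrite /nln ler_pM2l ?nat_e_gt0// ler_expR ler_wpM2r ?(ltW (lnln_nat_e _ en))//.
  by rewrite lerD2l -[leRHS]invrK lef_pV2 ?posrE ?invr_gt0// ltW// truncnS_gt.
split; apply: limn_esup_nln => //.
- by move=> N; exact: lb.
- by move=> d d0; have [N /(sE_M_le _ _ _ (ltW d0))] := ubx d d0.
- move=> N; have [n Nn hn] := lb x01 xirr N; exists n => //.
  exact: le_trans hn (sE_R_le_M x n).
Qed.
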